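(* Let $\Lambda\subset\mathbb{R}^2$ be a lattice with unit cell $Y$ and dual lattice $\Lambda^*$, and let $\beta\in\mathbb{R}^2$. The boundary value problem $$\begin{cases}\Delta v-2\beta\cdot\nabla v+|\beta|^2v=0,\quad\text{in }Y,\\ v(0)=0,\\ v(x+\ell)=e^{\mathrm{i}\alpha\cdot\ell}v(x),\quad\ell\in\Lambda,\end{cases}$$ admits a non-trivial solution given by $$v(x)=\sin(\kappa\cdot x)$$ at the high-symmetry points, i.e. the points $\kappa=\alpha+q$ with $q\in\Lambda^*$ that satisfy $$|\alpha+q|^2=|\beta|^2\quad\text{and}\quad(\alpha+q)\perp\beta .$$
   Context: A lattice $\Lambda\subset\mathbb{R}^2$ is the set of integer linear combinations of two linearly independent vectors $l_1,l_2$; its dual lattice is $\Lambda^*=\{k\in\mathbb{R}^2: k\cdot\ell\in2\pi\mathbb{Z}\ \forall\ell\in\Lambda\}$; $Y$ is a fundamental domain (unit cell) of $\Lambda$; $\alpha\in\mathbb{R}^2/\Lambda^*$ is the real quasimomentum and $\beta\in\mathbb{R}^2$ the imaginary part of the complex quasimomentum. The problem models an infinitesimally small resonator located at the centre of the unit cell (the origin), represented by a single point with Dirichlet condition, at frequency zero.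
   Formalization: High-symmetry points are also required to satisfy 2α ∈ Λ*, since otherwise sin(κ·x) need not be α-quasi-periodic (e.g. Λ = Z², α = κ = (1,0), β = (0,1)); non-triviality is claimed only for β ≠ 0, since β = 0 forces κ = 0 and v = 0. *)

(* Defs.v *)
From Stdlib Require Import Reals.
From Coquelicot Require Import Coquelicot.

Open Scope R_scope.

Notation R2 := (R * R)%type.

Definition dot (x y : R2) : R := fst x * fst y + snd x * snd y.

Definition enorm (x : R2) : R := sqrt (dot x x).

Definition orthogonal (x y : R2) : Prop := dot x y = 0.

Definition lin_indep (l1 l2 : R2) : Prop :=
  forall a b : R,
    plus (scal a l1) (scal b l2) = (0, 0) -> a = 0 /\ b = 0.

Definition is_lattice (L : R2 -> Prop) : Prop :=
  exists l1 l2 : R2, lin_indep l1 l2 /\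
    forall x : R2,
      L x <-> exists m n : Z, x = plus (scal (IZR m) l1) (scal (IZR n) l2).

Definition dual_lattice (L : R2 -> Prop) (k : R2) : Prop :=
  forall l : R2, L l -> exists n : Z, dot k l = 2 * PI * IZR n.

(* Every point of the plane has exactly one translate, by a lattice vector,
   in the unit cell. *)
Definition unit_cell (L Y : R2 -> Prop) : Prop :=
  forall x : R2, exists! y : R2, Y y /\ L (minus x y).

(* The class of [a] in R^2 / L^* is fixed by the inversion a |-> -a,
   i.e. a - (-a) = 2 a lies in L^*. *)
Definition high_symmetry (L : R2 -> Prop) (a : R2) : Prop :=
  dual_lattice L (minus a (opp a)).

(* e^{i t} for real t. *)
Definition cis (t : R) : C := (cos t, sin t).

(* Partial derivatives of a complex-valued function of two real variables.
   [Derive] is a total operator on real functions, hence the detour through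
   real and imaginary parts and the separate existence predicates. *)
Definition pd1 (f : R2 -> C) (x : R2) : C :=
  (Derive (fun t => Re (f (t, snd x))) (fst x),
   Derive (fun t => Im (f (t, snd x))) (fst x)).

Definition pd2 (f : R2 -> C) (x : R2) : C :=
  (Derive (fun t => Re (f (fst x, t))) (snd x),
   Derive (fun t => Im (f (fst x, t))) (snd x)).

Definition ex_pd1 (f : R2 -> C) (x : R2) : Prop :=
  ex_derive (V := C_R_NormedModule) (fun t : R => f (t, snd x)) (fst x).

Definition ex_pd2 (f : R2 -> C) (x : R2) : Prop :=
  ex_derive (V := C_R_NormedModule) (fun t : R => f (fst x, t)) (snd x).

Definition is_C1 (f : R2 -> C) : Prop :=
  forall x : R2,
    ex_pd1 f x /\ ex_pd2 f x /\ continuous (pd1 f) x /\ continuous (pd2 f) x.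

Definition is_C2 (f : R2 -> C) : Prop :=
  is_C1 f /\ is_C1 (pd1 f) /\ is_C1 (pd2 f).

Definition laplacian (f : R2 -> C) (x : R2) : C :=
  Cplus (pd1 (pd1 f) x) (pd2 (pd2 f) x).

(* b . grad f, for a real vector b. *)
Definition dot_grad (b : R2) (f : R2 -> C) (x : R2) : C :=
  Cplus (Cmult (RtoC (fst b)) (pd1 f x)) (Cmult (RtoC (snd b)) (pd2 f x)).

(* Classical solutions: as the quasi-periodicity condition refers to points
   outside Y, a solution is a C^2 function on the whole plane.  The
   quasimomentum in R^2 / L^* is given by a representative [alpha]; the phase
   factor does not depend on its choice. *)
Definition solves_bvp (L Y : R2 -> Prop) (alpha beta : R2) (v : R2 -> C) : Prop :=
  is_C2 v /\
  (forall x : R2, Y x ->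
     (laplacian v x - RtoC 2 * dot_grad beta v x
        + RtoC (enorm beta ^ 2) * v x)%C = RtoC 0) /\
  v (0, 0) = RtoC 0 /\
  (forall x l : R2, L l -> v (plus x l) = Cmult (cis (dot alpha l)) (v x)).

Definition nontrivial_on (Y : R2 -> Prop) (v : R2 -> C) : Prop :=
  exists x : R2, Y x /\ v x <> RtoC 0.

(* Main.v *)
(** All second derivatives of a plane wave are again plane waves with a shifted
    phase, so the equation reduces to [(- |kappa|^2 + |beta|^2) sin - 2 (beta . kappa) cos = 0].
    As [2 alpha] lies in the dual lattice, [kappa . l] is a multiple [n PI] of [PI]
    for every lattice vector [l], so that translation by [l] multiplies the sine by
    [(-1)^n = e^{i alpha . l}]. Hence a zero of [v] on the unit cell would spread to
    the whole plane, where [v] takes the value [1] if [kappa <> 0]. *)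
Require Import Defs.
From Stdlib Require Import Reals Lra FunctionalExtensionality.
From Coquelicot Require Import Coquelicot.

(* The phase [c] makes the family closed under differentiation. *)
Definition plane_wave (k : R2) (a c : R) (x : R2) : C :=
  RtoC (a * sin (dot k x + c)).

(** [RtoC r] is the real multiple [r] of the fixed vector [RtoC 1], so the rule for a scalar
    function times a constant vector applies. *)
Lemma is_derive_RtoC (f : R -> R) (x l : R) :
  is_derive f x l ->
  is_derive (V := C_R_NormedModule) (fun t => RtoC (f t)) x (RtoC l).
Proof.
  assert (Hscal : forall r : R, scal (V := C_R_NormedModule) r (RtoC 1) = RtoC r).
  { intros r; unfold RtoC, scal; simpl; unfold prod_scal, scal; simpl.
    unfold mult; simpl; f_equal; ring. }
  intros Hf; rewrite <- Hscal.
  apply (is_derive_ext (fun t => scal (V := C_R_NormedModule) (f t) (RtoC 1))).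
  - intros t; apply Hscal.
  - now apply (is_derive_scal_l (V := C_R_NormedModule)).
Qed.

Lemma continuous_RtoC (r : R) : continuous RtoC r.
Proof.
  intros P [e He]; exists e; intros y Hy; apply He; split.
  - exact Hy.
  (* Both imaginary parts are 0. *)
  - apply (ball_center (M := R_UniformSpace)).
Qed.

Lemma continuous_plane_wave (k : R2) (a c : R) (x : R2) :
  continuous (plane_wave k a c) x.
Proof.
  apply (continuous_comp (fun y : R2 => dot k y + c) (fun t => RtoC (a * sin t))).
  - unfold dot; repeat apply (continuous_plus (V := R_NormedModule));
      try apply continuous_const;
      apply (continuous_scal_r (K := R_AbsRing) (V := R_NormedModule)).
    + apply continuous_fst.
    + apply continuous_snd.
  - apply (continuous_comp (fun t => a * sin t) RtoC).
    + apply (ex_derive_continuous (V := R_NormedModule)); auto_derive; auto.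
    + apply continuous_RtoC.
Qed.

(** The cosine from the chain rule is written as a sine a quarter period ahead, which keeps the
    derivative in the family. *)
Lemma plane_wave_slice1 (k : R2) (a c : R) (x : R2) :
  is_derive (fun t => a * sin (dot k (t, snd x) + c)) (fst x)
    (a * fst k * sin (dot k x + (c + PI / 2))).
Proof.
  replace (dot k x + (c + PI / 2)) with (PI / 2 + (dot k x + c)) by ring.
  rewrite <- cos_sin; unfold dot; simpl.
  auto_derive; [ auto | ring ].
Qed.

Lemma plane_wave_slice2 (k : R2) (a c : R) (x : R2) :
  is_derive (fun t => a * sin (dot k (fst x, t) + c)) (snd x)
    (a * snd k * sin (dot k x + (c + PI / 2))).
Proof.
  replace (dot k x + (c + PI / 2)) with (PI / 2 + (dot k x + c)) by ring.
  rewrite <- cos_sin; unfold dot; simpl.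
  auto_derive; [ auto | ring ].
Qed.

(** An equality of functions, not of values, so that it can be rewritten inside a further partial
    derivative. *)
Lemma pd1_plane_wave (k : R2) (a c : R) :
  pd1 (plane_wave k a c) = plane_wave k (a * fst k) (c + PI / 2).
Proof.
  apply functional_extensionality; intros x.
  unfold pd1, plane_wave, RtoC; simpl.
  f_equal; [ apply is_derive_unique, plane_wave_slice1 | apply Derive_const ].
Qed.

Lemma pd2_plane_wave (k : R2) (a c : R) :
  pd2 (plane_wave k a c) = plane_wave k (a * snd k) (c + PI / 2).
Proof.
  apply functional_extensionality; intros x.
  unfold pd2, plane_wave, RtoC; simpl.
  f_equal; [ apply is_derive_unique, plane_wave_slice2 | apply Derive_const ].
Qed.

Lemma is_C1_plane_wave (k : R2) (a c : R) : is_C1 (plane_wave k a c).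
Proof.
  intros x; rewrite pd1_plane_wave, pd2_plane_wave.
  split; [ | split; [ | split; apply continuous_plane_wave ] ].
  - eexists; apply is_derive_RtoC, plane_wave_slice1.
  - eexists; apply is_derive_RtoC, plane_wave_slice2.
Qed.

Lemma is_C2_plane_wave (k : R2) (a c : R) : is_C2 (plane_wave k a c).
Proof.
  unfold is_C2; rewrite pd1_plane_wave, pd2_plane_wave.
  split; [ | split ]; apply is_C1_plane_wave.
Qed.

Lemma plane_wave_sin (k : R2) :
  (fun x => RtoC (sin (dot k x))) = plane_wave k 1 0.
Proof.
  apply functional_extensionality; intros x; unfold plane_wave.
  now rewrite Rmult_1_l, Rplus_0_r.
Qed.

Lemma enorm_sqr (x : R2) : enorm x ^ 2 = dot x x.
Proof.
  apply pow2_sqrt; unfold dot; nra.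
Qed.

Lemma laplacian_sin (k x : R2) :
  laplacian (fun y => RtoC (sin (dot k y))) x =
  RtoC (- dot k k * sin (dot k x)).
Proof.
  rewrite plane_wave_sin; unfold laplacian.
  rewrite pd1_plane_wave, pd2_plane_wave, pd1_plane_wave, pd2_plane_wave.
  unfold plane_wave; rewrite <- RtoC_plus; f_equal.
  (* Two quarter periods add up to [PI], which flips the sign of the sine. *)
  replace (dot k x + (0 + PI / 2 + PI / 2)) with (dot k x + PI) by field.
  rewrite neg_sin; unfold dot; ring.
Qed.

Lemma dot_grad_sin (b k x : R2) :
  dot_grad b (fun y => RtoC (sin (dot k y))) x =
  RtoC (dot b k * cos (dot k x)).
Proof.
  rewrite plane_wave_sin; unfold dot_grad.
  rewrite pd1_plane_wave, pd2_plane_wave; unfold plane_wave.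
  rewrite <- !RtoC_mult, <- RtoC_plus; f_equal.
  replace (dot k x + (0 + PI / 2)) with (PI / 2 + dot k x) by field.
  rewrite <- cos_sin; unfold dot; ring.
Qed.

Lemma plus_minus_cancel {G : AbelianGroup} (x y : G) : plus y (minus x y) = x.
Proof.
  unfold minus; rewrite (plus_comm x), plus_assoc, plus_opp_r; apply plus_zero_l.
Qed.

Lemma dot_plus_l (x y z : R2) : dot (plus x y) z = dot x z + dot y z.
Proof. unfold dot, plus; simpl; unfold plus; simpl; ring. Qed.

Lemma dot_plus_r (x y z : R2) : dot x (plus y z) = dot x y + dot x z.
Proof. unfold dot, plus; simpl; unfold plus; simpl; ring. Qed.

Lemma sin_IZR_PI (n : Z) : sin (PI * IZR n) = 0.
Proof. apply sin_eq_0_1; exists n; ring. Qed.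

(** This removes [q] from the phase of a translation, since [dot q l] is a multiple of [2 * PI]. *)
Lemma cis_period (t : R) (n : Z) : cis (t + 2 * PI * IZR n) = cis t.
Proof.
  assert (Hs : sin (2 * PI * IZR n) = 0).
  { replace (2 * PI * IZR n) with (PI * IZR (2 * n)) by (rewrite mult_IZR; ring).
    apply sin_IZR_PI. }
  assert (Hc : cos (2 * PI * IZR n) = 1).
  { replace (2 * PI * IZR n) with (2 * (PI * IZR n)) by ring.
    rewrite cos_2a_sin, sin_IZR_PI; ring. }
  unfold cis; rewrite cos_plus, sin_plus, Hs, Hc; f_equal; ring.
Qed.

(** Halving [2 * dot a l = 2 * PI * n] puts [dot a l] among the zeros of the sine. *)
Lemma high_symmetry_sin (L : R2 -> Prop) (a l : R2) :
  high_symmetry L a -> L l -> sin (dot a l) = 0.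
Proof.
  intros Ha Hl; destruct (Ha l Hl) as [n Hn].
  replace (dot a l) with (PI * IZR n); [ apply sin_IZR_PI | ].
  unfold dot, minus, opp, plus in *; simpl in *; unfold opp, plus in *; simpl in *; lra.
Qed.

Lemma sin_quasi_periodic (L : R2 -> Prop) (alpha q x l : R2) :
  dual_lattice L q -> high_symmetry L alpha -> L l ->
  RtoC (sin (dot (plus alpha q) (plus x l))) =
  Cmult (cis (dot alpha l)) (RtoC (sin (dot (plus alpha q) x))).
Proof.
  intros Hq Ha Hl; destruct (Hq l Hl) as [n Hn].
  pose proof (high_symmetry_sin L alpha l Ha Hl) as Hs.
  assert (Hk : cis (dot (plus alpha q) l) = cis (dot alpha l)).
  { now rewrite dot_plus_l, Hn, cis_period. }
  unfold cis in Hk |- *; injection Hk as Hc1 Hs1.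
  (* With [sin (dot alpha l) = 0] the cosine term of the addition formula drops out, and the phase
     is the real number [cos (dot alpha l)]. *)
  rewrite dot_plus_r, sin_plus, Hc1, Hs1, Hs.
  unfold Cmult, RtoC; simpl; f_equal; ring.
Qed.

Theorem lemma3p4
  (L Y : R2 -> Prop) (hL : is_lattice L) (hY : unit_cell L Y)
  (alpha beta q kappa : R2)
  (hq : dual_lattice L q)
  (hkappa : kappa = plus alpha q)
  (hsym : high_symmetry L alpha)
  (hnorm : (enorm kappa ^ 2 = enorm beta ^ 2)%R)
  (hperp : orthogonal kappa beta) :
  let v := fun x : R2 => RtoC (sin (dot kappa x)) in
  solves_bvp L Y alpha beta v /\
  (beta <> (0, 0)%R -> nontrivial_on Y v).
Proof.
  intros v.
  assert (Hper : forall x l : R2, L l ->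
    v (plus x l) = Cmult (cis (dot alpha l)) (v x)).
  { intros x l Hl; unfold v; rewrite hkappa.
    now apply (sin_quasi_periodic L). }
  rewrite !enorm_sqr in hnorm; unfold orthogonal in hperp.
  split; [ split; [ | split; [ | split ] ] | ].
  - unfold v; rewrite plane_wave_sin; apply is_C2_plane_wave.
  - intros x _; unfold v.
    rewrite laplacian_sin, dot_grad_sin, enorm_sqr, <- hnorm.
    (* Orthogonality removes the gradient term; the two sine terms cancel because the norms
       agree. *)
    replace (dot beta kappa) with 0 by (rewrite <- hperp; unfold dot; ring).
    rewrite <- !RtoC_mult, <- RtoC_minus, <- RtoC_plus; f_equal; ring.
  - unfold v, dot; simpl; rewrite !Rmult_0_r, Rplus_0_r, sin_0; reflexivity.
  - exact Hper.
  - intros Hb.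
    assert (Hk : dot kappa kappa <> 0).
    { rewrite hnorm; intros H0; apply Hb; destruct beta as [b1 b2].
      unfold dot in H0; simpl in H0; f_equal; nra. }
    (* Scaled so that [dot kappa x = PI / 2], where the sine is 1. *)
    set (x := scal (PI / 2 / dot kappa kappa) kappa : R2).
    assert (Hx : v x = RtoC 1).
    { unfold v; f_equal.
      replace (dot kappa x) with (PI / 2); [ apply sin_PI2 | ].
      transitivity (PI / 2 / dot kappa kappa * dot kappa kappa); [ now field | ].
      unfold x, dot, scal; simpl; unfold scal, mult; simpl; unfold mult; simpl; ring. }
    (* As [x] may lie outside [Y], its representative [y] in the cell serves as witness: [v x] is a
       phase times [v y]. *)
    destruct (hY x) as [y [[Yy Hl] _]].
    exists y; split; [ exact Yy | intros Hy ].
    assert (Hxy : x = plus y (minus x y)).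
    { symmetry; apply (plus_minus_cancel (G := prod_AbelianGroup R_AbelianGroup R_AbelianGroup)). }
    rewrite Hxy, (Hper _ _ Hl), Hy, Cmult_0_r in Hx.
    apply RtoC_inj in Hx; lra.
Qed.
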